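(* Let $\Delta=(N_1,\dots,N_l)$ be a partition of $n$ with $N_1\le\dots\le N_l\le p$, let $z\in M(d,n;\mathbb{F}_q)$ and let $\chi$ be a character of $H_\Delta$. Then $$N(X_{\Delta,z};\chi)=\Phi_\Delta(\chi;z).$$
   Context: $q$ is a power of a prime $p$, $N=q-1$, $\psi$ a fixed nontrivial additive character of $\mathbb{F}_q$, $\psi_a(x)=\psi(ax)$; multiplicative characters satisfy $\alpha(0)=0$. For $m\ge1$ let $\Lambda$ be the $m\times m$ matrix with $1$'s on the superdiagonal and $0$ elsewhere, $[h_0,\dots,h_{m-1}]=\sum_i h_i\Lambda^i$, $J(m)=\{[h_0,\dots,h_{m-1}]:h_0\in\mathbb{F}_q^*,h_i\in\mathbb{F}_q\}$. For $x=(x_0,x_1,\dots)$, $X_j=x_j/x_0$, let $\theta_i(x)=\sum_{k_1+2k_2+\dots+ik_i=i,\,k_j\ge0}(-1)^{k_1+\dots+k_i-1}\frac{(k_1+\dots+k_i-1)!}{k_1!\cdots k_i!}X_1^{k_1}\cdots X_i^{k_i}$, $\overline\theta_i(x)=x_0^i\theta_i(x)$ (a polynomial in $x_0,\dots,x_i$), and $\theta_i([h_0,\dots,h_{m-1}])=\theta_i(h_0,\dots,h_i)$. $H_\Delta=\{\mathrm{diag}(h_1,\dots,h_l):h_i\in J(N_i)\}$; the map $\widetilde\iota(\mathrm{diag}(h_i))=(h_{i,0},\theta_1(h_i),\dots,\theta_{N_i-1}(h_i))_i$ is an isomorphism $H_\Delta\to G_\Delta:=\prod_{i=1}^l(\mathbb{F}_q^*\times\mathbb{F}_q^{N_i-1})$,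 and characters of $H_\Delta$ are $\chi=\chi'\circ\widetilde\iota$ with $\chi'$ a character of $G_\Delta$. Write $z=(z^{(1)},\dots,z^{(l)})$, $z^{(i)}=(z^{(i)}_0,\dots,z^{(i)}_{N_i-1})$ consecutive column blocks. For $s\in\mathbb{F}_q^d$ (row), $\chi_i(sz^{(i)})=\chi_i([sz^{(i)}_0,\dots,sz^{(i)}_{N_i-1}])$ if $sz^{(i)}_0\ne0$ and $0$ otherwise, $\chi(sz)=\prod_i\chi_i(sz^{(i)})$, $\Phi_\Delta(\chi;z)=\sum_{s\in\mathbb{F}_q^d}\chi(sz)$. $X_{\Delta,z}\subset\mathbb{A}^{n+d}$ is the affine variety over $\mathbb{F}_q$ in coordinates $t_i$ ($1\le i\le l$), $u_{(i,j)}$ ($1\le i\le l$, $1\le j\le N_i-1$), $s=(s_1,\dots,s_d)$, defined by $t_i^N=sz_0^{(i)}$, $t_i^{Nj}(u_{(i,j)}^q-u_{(i,j)})=\overline\theta_j(sz^{(i)})$ for $1\le j\le N_i-1$, and $t_i\ne0$, for all $i$. $G_\Delta$ acts on $X_{\Delta,z}$ by $(\xi_i,a_{(i,j)})\cdot(t_i,u_{(i,j)},s)=(\xi_it_i,u_{(i,j)}+a_{(i,j)},s)$, and $H_\Delta$ acts through $\widetilde\iota$. For a variety $X$ over $\mathbb{F}_q$ with an action of a finite abelian group $G$ and a character $\chi$ of $G$, $N(X;\chi)=\frac1{\#G}\sum_{g\in G}\chi(g)\Lambda_g$ with $\Lambda_g=\#\{P\in X(\overline{\mathbb{F}}_q):\mathrm{Frob}(P)=g\cdot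 P\}$, $\mathrm{Frob}$ the $q$-Frobenius. *)

(* Defs.v *)
From HB Require Import structures.
From mathcomp Require Import all_boot all_order all_algebra all_field.
From mathcomp Require Import finmap boolp classical_sets cardinality.

Set Implicit Arguments.
Unset Strict Implicit.
Unset Printing Implicit Defensive.

Import GRing.Theory.
Local Open Scope ring_scope.

(* Matrix entries with natural-number indices starting at 0, and value 0 out
   of range; [fun j => entry A 0 j] is the sequence of entries of the first
   row of [A]. *)
Definition entry (R : nmodType) (m n : nat) (A : 'M[R]_(m, n)) (i j : nat) : R :=
  if insub i is Some i' then if insub j is Some j' then A i' j' else 0 else 0.

Definition shift_mx (R : pzRingType) (m : nat) : 'M[R]_m :=
  \matrix_(i, j) (j == i.+1 :> nat)%:R.

(* [h_0, ..., h_(m-1)] *)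
Definition toep (R : pzRingType) (m : nat) (h : nat -> R) : 'M[R]_m :=
  \sum_(i < m) h i *: shift_mx R m ^+ i.

Definition J (F : finFieldType) (m : nat) : {set 'M[F]_m} :=
  [set toep m (entry h 0) | h : 'rV[F]_m & entry h 0 0 != 0].

(* [k j : 'I_i.+1] is the exponent k_(j+1) of X_(j+1); the weight condition
   forces all exponents to be at most i.  The quotient of integers is taken
   in R, where the denominators are invertible as soon as i < char R. *)
Definition theta (R : fieldType) (i : nat) (x : nat -> R) : R :=
  \sum_(k : {ffun 'I_i -> 'I_i.+1} | (\sum_(j < i) j.+1 * k j == i)%N)
    (-1) ^+ (\sum_(j < i) k j).-1
    * (((\sum_(j < i) k j).-1)`!%:R / (\prod_(j < i) (k j)`!)%:R)
    * \prod_(j < i) (x j.+1 / x 0%N) ^+ k j.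

(* As in [theta], x 0 is inverted: this agrees with the polynomial where
   x 0 != 0, and on [XDelta] below x 0 = t ^ N is nonzero. *)
Definition theta_bar (R : fieldType) (i : nat) (x : nat -> R) : R :=
  x 0%N ^+ i * theta i x.

(* N(X; chi) for a finite group G acting on the set X of geometric points of
   a variety with Frobenius map Frob. *)
Definition twisted_points (T gT : Type) (X : set T) (Frob : T -> T)
    (act : gT -> T -> T) (g : gT) : set T :=
  [set P | X P /\ Frob P = act g P]%classic.

Definition twisted_count (T : choiceType) (gT : finType) (X : set T)
    (Frob : T -> T) (G : {set gT}) (act : gT -> T -> T) (chi : gT -> algC)
    : algC :=
  #|G|%:R^-1 *
  \sum_(g in G) chi g * #|` fset_set (twisted_points X Frob act g)|%:R.

Section Delta.

Variables (F : finFieldType) (l : nat) (Delta : 'I_l -> nat).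

Local Notation n := (\sum_i Delta i)%N.

Definition HDelta : {set 'M[F]_n} :=
  [set \mxdiag_i h i
  | h : {dffun forall i, 'M[F]_(Delta i)} in setXn (fun i => J F (Delta i))].

Definition is_char_HDelta (chi : 'M[F]_n -> algC) : Prop :=
  chi 1%:M = 1 /\ {in HDelta &, {morph chi : g h / g *m h >-> g * h}}.

(* The underlying type of G_Delta = prod_i (F^* x F^(Delta i - 1)): the first
   component is the family of the F^*-coordinates, the second one is cut into
   consecutive blocks of lengths Delta i - 1.  Index j : 'I_(Delta i).-1 of
   block i stands for the pair (i, j + 1). *)
Definition GDeltaT := ('rV[F]_l * 'rV[F]_(\sum_i (Delta i).-1))%type.

Definition iotat (h : 'M[F]_n) : GDeltaT :=
  (\row_i entry (submxblock h i i) 0 0,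
   \mxrow_i \row_(j < (Delta i).-1) theta j.+1 (entry (submxblock h i i) 0)).

(* chi_i, as a character of J(Delta i) *)
Definition char_block (chi : 'M[F]_n -> algC) (i : 'I_l) (h : 'M[F]_(Delta i))
    : algC :=
  chi (\mxdiag_k dfwith (fun k => 1%:M : 'M[F]_(Delta k)) h k).

(* The sequence (s z^(i)_0, s z^(i)_1, ...). *)
Definition block_seq (R : pzRingType) (d : nat) (s : 'rV[R]_d)
    (z : 'M[R]_(d, n)) (i : 'I_l) : nat -> R :=
  entry (s *m submxrow z i) 0.

Definition char_at (chi : 'M[F]_n -> algC) (d : nat) (s : 'rV[F]_d)
    (z : 'M[F]_(d, n)) : algC :=
  \prod_i (let x := block_seq s z i in
           if x 0%N != 0 then char_block chi (toep (Delta i) x) else 0).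

Definition Phi (chi : 'M[F]_n -> algC) (d : nat) (z : 'M[F]_(d, n)) : algC :=
  \sum_(s : 'rV[F]_d) char_at chi s z.

Variables (K : fieldType) (f : {rmorphism F -> K}).

(* Affine space of dimension l + sum_i (Delta i - 1) + d, with coordinates
   (t, u, s); the blocks of u are indexed as for [GDeltaT]. *)
Definition ptT (d : nat) : choiceType :=
  ('rV[K]_l * 'rV[K]_(\sum_i (Delta i).-1) * 'rV[K]_d)%type.

Definition XDelta (d : nat) (z : 'M[F]_(d, n)) : set (ptT d) :=
  [set P : ptT d | let: (t, u, s) := P in
    forall i : 'I_l,
      let x := block_seq s (map_mx f z) i in
      [/\ t 0 i ^+ #|F|.-1 = x 0%N,
          forall j : 'I_(Delta i).-1,
            t 0 i ^+ (#|F|.-1 * j.+1)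
              * (submxrow u i 0 j ^+ #|F| - submxrow u i 0 j)
            = theta_bar j.+1 x
        & t 0 i != 0]]%classic.

Definition FrobP (d : nat) (P : ptT d) : ptT d :=
  let: (t, u, s) := P in
  let Fr a := a ^+ #|F| in
  (map_mx Fr t, map_mx Fr u, map_mx Fr s).

Definition actG (d : nat) (g : GDeltaT) (P : ptT d) : ptT d :=
  let: (t, u, s) := P in
  (\row_i (f (g.1 0 i) * t 0 i), u + map_mx f g.2, s).

Definition actH (d : nat) (h : 'M[F]_n) (P : ptT d) : ptT d :=
  actG (iotat h) P.

Definition NX (d : nat) (z : 'M[F]_(d, n)) (chi : 'M[F]_n -> algC) : algC :=
  twisted_count (XDelta z) (@FrobP d) HDelta (@actH d) chi.

End Delta.

(* [fset_set] sends infinite sets to the empty one; the sets counted in [NX]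
   are finite. *)
Lemma finite_twisted_points (F : finFieldType) (l : nat) (Delta : 'I_l -> nat)
    (K : closedFieldType) (f : {rmorphism F -> K}) (d : nat)
    (z : 'M[F]_(d, \sum_i Delta i)) (h : 'M[F]_(\sum_i Delta i)) :
  finite_set (twisted_points (XDelta f z) (@FrobP F l Delta K d)
                (@actH F l Delta K f d) h).
Proof.
pose q := #|F|.
have q_gt1 : (1 < q)%N by exact: finNzRing_gt1.
pose pol (cb : F * F) : {poly K} := 'X^q - (f cb.1 *: 'X + (f cb.2)%:P).
have pol_neq0 cb : pol cb != 0.
  have sz : (size (f cb.1 *: 'X + (f cb.2)%:P)%R <= 2)%N.
    apply: leq_trans (size_polyD _ _) _; rewrite geq_max.
    rewrite (leq_trans (size_scale_leq _ _)) ?size_polyX //=.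
    by rewrite (leq_trans (size_polyC_leq1 _)).
  rewrite -size_poly_eq0 /pol size_polyDl ?size_polyXn //.
  by rewrite size_polyN (leq_ltn_trans sz).
have roots cb : exists r : seq K, forall a, root (pol cb) a -> a \in r.
  have [r Er] := closed_field_poly_normal (pol cb).
  exists r => a; rewrite Er rootZ ?lead_coef_eq0 //.
  by rewrite root_prod_XsubC.
have [r Hr] := choice roots.
pose S := flatten [seq r cb | cb <- enum {: F * F}].
have inS (a : K) (c b : F) : a ^+ q = f c * a + f b -> a \in S.
  move=> Ea; apply/flattenP; exists (r (c, b)).
    by apply: map_f; rewrite mem_enum.
  by apply: Hr; rewrite /root /pol !hornerE Ea subrr.
have fin m : finite_set [set v : 'rV[K]_m | forall j, v 0 j \in S]%classic.
  pose g (w : 'rV[seq_sub S]_m) := map_mx val w.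
  apply: (@sub_finite_set _ _ [set g w | w in [set: _]]%classic).
    move=> v /= vS; exists (\row_j SeqSub (vS j)) => //.
    by apply/rowP => j; rewrite !mxE.
  exact/finite_image/finite_finset.
apply: sub_finite_set (finite_setX (finite_setX (fin l) (fin _)) (fin d)).
move=> [[t u] s] /= [_ [Et Eu Es]]; split; [split|] => j /=.
- move/rowP/(_ j): Et; rewrite !mxE => Et.
  by apply: (inS _ (entry (submxblock h j j) 0 0) 0); rewrite Et rmorph0 addr0.
- move/rowP/(_ j): Eu; rewrite !mxE => Eu.
  by apply: (inS _ 1 ((iotat h).2 0 j)); rewrite Eu rmorph1 mul1r !mxE.
- move/rowP/(_ j): Es; rewrite !mxE => Es.
  by apply: (inS _ 1 0); rewrite Es rmorph0 addr0 rmorph1 mul1r.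
Qed.

(* Main.v *)
(** Let L(t, u) = (t^(q-1), u^q - u) be the Lang map of G_Delta.  Over the
    algebraically closed field K it is surjective, and its fibres away from
    t = 0 are the orbits of G_Delta(F_q).  Frob P = h P, for a point
    P = (t, u, s) of X_(Delta, z), says that s is rational and
    L(t, u) = iota(h), whereas the equations of X_(Delta, z) at a rational s
    say that sz lies in H_Delta and L(t, u) = iota(sz).  As iota is injective,
    sz = h; hence Lambda_h is #H_Delta times the number of s with sz = h, and
    averaging against chi gives the sum of chi(sz) over the s with sz in
    H_Delta.  Only the bijectivity of iota is needed, not its being a morphism:
    it holds because theta_j is X_j plus a polynomial in X_1, ..., X_(j-1). *)

Require Import Defs.
From mathcomp Require Import all_boot all_order all_algebra all_field.
From mathcomp Require Import finmap boolp classical_sets cardinality.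

Set Implicit Arguments.
Unset Strict Implicit.
Unset Printing Implicit Defensive.

Import GRing.Theory.
Local Open Scope ring_scope.

(** * Block matrices and upper triangular Toeplitz matrices *)

Lemma mul_mxdiag (R : pzSemiRingType) (p : nat) (p_ : 'I_p -> nat)
    (A B : forall i, 'M[R]_(p_ i)) :
  \mxdiag_i A i *m \mxdiag_i B i = \mxdiag_i (A i *m B i).
Proof.
rewrite [X in _ *m X]/mxdiag mul_mxdiag_mxblock.
apply: eq_mxblock => i j; case: eqP => [e|_]; last by rewrite mulmx0.
by case: _ / e; rewrite !conform_mx_id.
Qed.

Lemma map_submxrow (aT rT : Type) (g : aT -> rT) (m q : nat) (q_ : 'I_q -> nat)
    (A : 'M[aT]_(m, \sum_i q_ i)) (j : 'I_q) :
  submxrow (map_mx g A) j = map_mx g (submxrow A j).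
Proof. by apply/matrixP => a b; rewrite !mxE. Qed.

Lemma submxrowP (T : Type) (m q : nat) (q_ : 'I_q -> nat)
    (A B : 'M[T]_(m, \sum_i q_ i)) :
  (forall j, submxrow A j = submxrow B j) <-> A = B.
Proof.
split=> [eqAB|-> //].
by rewrite -[A]submxrowK -[B]submxrowK; apply: eq_mxrow.
Qed.

Lemma map_entry (R S : nmodType) (g : {additive R -> S}) (m n : nat)
    (A : 'M[R]_(m, n)) (i j : nat) :
  entry (map_mx g A) i j = g (entry A i j).
Proof.
rewrite /entry; case: insub => [i'|]; last by rewrite raddf0.
by case: insub => [j'|]; rewrite ?raddf0 ?mxE.
Qed.

Lemma entry_ord (R : nmodType) (m n : nat) (A : 'M[R]_(m, n)) (i : 'I_m)
  (j : 'I_n) : entry A i j = A i j.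
Proof. by rewrite /entry !valK. Qed.

Lemma shift_mxX (R : pzRingType) (m k : nat) (i j : 'I_m) :
  (shift_mx R m ^+ k) i j = (j == i + k :> nat)%N%:R.
Proof.
elim: k i j => [|k IHk] i j.
  by rewrite expr0 addn0 [1]/(1%:M) mxE eq_sym.
rewrite exprS -mulmxE mxE; under eq_bigr do rewrite IHk mxE.
have [lt_im|le_mi] := ltnP i.+1 m.
  rewrite (bigD1 (Ordinal lt_im)) //= eqxx mul1r big1 ?addr0 ?addSnnS //.
  by move=> a; rewrite -val_eqE /= => /negbTE ->; rewrite mul0r.
rewrite big1 => [|a _]; last first.
  by rewrite ltn_eqF ?mul0r // (leq_trans (ltn_ord a)).
rewrite ltn_eqF // (leq_trans (ltn_ord j)) // (leq_trans le_mi) //.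
by rewrite addnS ltnS leq_addr.
Qed.

Lemma toepE (R : pzRingType) (m : nat) (x : nat -> R) (i j : 'I_m) :
  toep m x i j = if (i <= j)%N then x (j - i)%N else 0.
Proof.
rewrite summxE; under eq_bigr do rewrite mxE shift_mxX.
have [le_ij|lt_ji] := leqP i j; last first.
  by apply: big1 => k _; rewrite ltn_eqF ?mulr0 // ltn_addr.
have lt_m : (j - i < m)%N by rewrite (leq_ltn_trans (leq_subr _ _)).
rewrite (bigD1 (Ordinal lt_m)) //= subnKC // eqxx mulr1 big1 ?addr0 // => k.
rewrite -val_eqE /= => neq; case: eqP => [ej|_]; last exact: mulr0.
by rewrite ej addKn eqxx in neq.
Qed.

Lemma entry_toep (R : pzRingType) (m : nat) (x : nat -> R) (j : nat) :
  (j < m)%N -> entry (toep m x) 0 j = x j.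
Proof.
move=> lt_jm; have m_gt0 : (0 < m)%N by apply: leq_trans lt_jm.
by rewrite (entry_ord _ (Ordinal m_gt0) (Ordinal lt_jm)) toepE /= subn0.
Qed.

Lemma eq_toep (R : pzRingType) (m : nat) (x y : nat -> R) :
  (forall j, (j < m)%N -> x j = y j) -> toep m x = toep m y.
Proof. by move=> exy; apply: eq_bigr => j _; rewrite exy. Qed.

Lemma toep1 (R : pzRingType) (m : nat) :
  toep m (fun j => (j == 0)%N%:R) = 1%:M :> 'M[R]_m.
Proof.
apply/matrixP => i j; rewrite toepE mxE -val_eqE /=.
by rewrite subn_eq0 eqn_leq; case: leqP.
Qed.

Lemma toep_in_J (F : finFieldType) (m : nat) (x : nat -> F) :
  (0 < m)%N -> (toep m x \in J F m) = (x 0%N != 0).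
Proof.
move=> m_gt0; apply/imsetP/idP => [[h + /(congr1 (fun A => entry A 0 0))]|x0].
  by rewrite inE !entry_toep // => h0 ->.
have ex j : (j < m)%N -> entry (\row_(k < m) x k) 0 j = x j.
  by move=> lt_jm; rewrite (entry_ord _ ord0 (Ordinal lt_jm)) mxE.
by exists (\row_(j < m) x j); rewrite ?inE ?ex //; apply: eq_toep => j /ex.
Qed.

Lemma J_toep (F : finFieldType) (m : nat) (A : 'M[F]_m) :
  A \in J F m -> exists x, A = toep m x.
Proof. by case/imsetP => h _ ->; exists (entry h 0). Qed.

Lemma scalar1_in_J (F : finFieldType) (m : nat) :
  (0 < m)%N -> 1%:M \in J F m.
Proof. by move=> m_gt0; rewrite -toep1 toep_in_J // oner_neq0. Qed.

(** * The polynomials theta *)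

Definition theta_weight (i : nat) (k : {ffun 'I_i -> 'I_i.+1}) : nat :=
  \sum_(j < i) j.+1 * k j.

Definition theta_term (R : fieldType) (i : nat) (x : nat -> R)
    (k : {ffun 'I_i -> 'I_i.+1}) : R :=
  (-1) ^+ (\sum_(j < i) k j).-1
  * (((\sum_(j < i) k j).-1)`!%:R / (\prod_(j < i) (k j)`!)%:R)
  * \prod_(j < i) (x j.+1 / x 0%N) ^+ k j.

Lemma thetaE (R : fieldType) (i : nat) (x : nat -> R) :
  theta i x =
  \sum_(k : {ffun 'I_i -> 'I_i.+1} | theta_weight k == i) theta_term x k.
Proof. by []. Qed.

Lemma eq_theta (R : fieldType) (i : nat) (x y : nat -> R) :
  (forall j, (j <= i)%N -> x j = y j) -> theta i x = theta i y.
Proof.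
move=> exy; rewrite /theta; apply: eq_bigr => k _; congr (_ * _).
by apply: eq_bigr => j _; rewrite !exy.
Qed.

Lemma map_theta (R S : fieldType) (f : {rmorphism R -> S}) (i : nat)
    (x : nat -> R) :
  theta i (f \o x) = f (theta i x).
Proof.
rewrite /theta rmorph_sum; apply: eq_bigr => k _.
rewrite !rmorphM rmorphXn rmorphN1 fmorphV !rmorph_nat.
congr (_ * _); rewrite rmorph_prod; apply: eq_bigr => j _.
by rewrite rmorphXn fmorph_div.
Qed.

Lemma theta_barP (R : fieldType) (i : nat) (x : nat -> R) (a : R) :
  x 0%N != 0 -> x 0%N ^+ i * a = theta_bar i x <-> a = theta i x.
Proof. by move=> x0; split=> [/(mulfI (expf_neq0 _ x0))|->]. Qed.

(* The exponents of the monomial X_(i+1), which has index i in [theta]. *)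
Definition last_monomial (i : nat) : {ffun 'I_i.+1 -> 'I_i.+2} :=
  [ffun j : 'I_i.+1 => inord (j == i :> nat)].

Lemma last_monomialE (i : nat) (j : 'I_i.+1) :
  last_monomial i j = (j == i :> nat) :> nat.
Proof. by rewrite ffunE inordK //; case: eqP. Qed.

Lemma last_monomial_widen (i : nat) (j : 'I_i) :
  last_monomial i (widen_ord (leqnSn i) j) = 0%N :> nat.
Proof. by rewrite last_monomialE /= ltn_eqF. Qed.

Lemma last_monomial_max (i : nat) : last_monomial i ord_max = 1%N :> nat.
Proof. by rewrite last_monomialE eqxx. Qed.

Lemma theta_weight_last_monomial (i : nat) :
  theta_weight (last_monomial i) = i.+1.
Proof.
rewrite /theta_weight big_ord_recr /= last_monomial_max muln1 big1 // => j _.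
by rewrite last_monomial_widen muln0.
Qed.

Lemma theta_term_last_monomial (R : fieldType) (i : nat) (x : nat -> R) :
  theta_term x (last_monomial i) = x i.+1 / x 0%N.
Proof.
rewrite /theta_term !big_ord_recr /= last_monomial_max.
rewrite !big1 => [|j _|j _|j _]; rewrite ?last_monomial_widen //.
by rewrite !add0n !mul1n !mul1r invr1 mul1r.
Qed.

Lemma last_monomial_unique (i : nat) (k : {ffun 'I_i.+1 -> 'I_i.+2}) :
  theta_weight k = i.+1 -> k ord_max != 0%N :> nat -> k = last_monomial i.
Proof.
rewrite /theta_weight big_ord_recr /= => + k_max.
rewrite -[k ord_max : nat]prednK ?lt0n // mulnS addnCA -[RHS]addn0.
move/addnI/eqP; rewrite addn_eq0 sum_nat_eq0 muln_eq0 /=.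
case/andP=> /forallP k_low /eqP k_max0.
apply/ffunP => j; apply: val_inj => /=.
have [j' ->|->] := unliftP ord_max j; last first.
  by rewrite last_monomial_max -[LHS]prednK ?lt0n // k_max0.
have -> : lift ord_max j' = widen_ord (leqnSn i) j' by apply/val_inj/lift_max.
by have := k_low j'; rewrite last_monomial_widen muln_eq0 => /eqP.
Qed.

Lemma eq_theta_term (R : fieldType) (i : nat) (k : {ffun 'I_i.+1 -> 'I_i.+2})
    (x y : nat -> R) :
  k ord_max = 0%N :> nat -> (forall j, (j <= i)%N -> x j = y j) ->
  theta_term x k = theta_term y k.
Proof.
move=> k_max0 exy; congr (_ * _).
rewrite !big_ord_recr /= k_max0 !expr0.
by congr (_ * _); apply: eq_bigr => j _; rewrite !exy.
Qed.

Lemma theta_triangular (R : fieldType) (i : nat) (x y : nat -> R) :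
  (forall j, (j <= i)%N -> x j = y j) ->
  theta i.+1 x - x i.+1 / x 0%N = theta i.+1 y - y i.+1 / y 0%N.
Proof.
have weight_last : theta_weight (last_monomial i) == i.+1.
  by rewrite theta_weight_last_monomial.
move=> exy; rewrite !thetaE !(bigD1 _ weight_last) /=.
rewrite !theta_term_last_monomial ![_ / _ + _]addrC !addrK.
apply: eq_bigr => k /andP[/eqP wt_k neq_k]; apply: eq_theta_term exy.
by apply/eqP; apply: contraNT neq_k => k_max; apply/eqP/last_monomial_unique.
Qed.

Lemma theta_inj (R : fieldType) (m : nat) (x y : nat -> R) :
  x 0%N != 0 -> x 0%N = y 0%N ->
  (forall j, (j < m)%N -> theta j.+1 x = theta j.+1 y) ->
  forall j, (j <= m)%N -> x j = y j.
Proof.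
move=> x0_neq0 exy0 exy j; elim/ltn_ind: j => -[|j] // IHj lt_jm.
have /theta_triangular : forall k, (k <= j)%N -> x k = y k.
  by move=> k le_kj; apply: IHj => //; apply: ltnW (leq_ltn_trans le_kj lt_jm).
rewrite exy // -exy0 => /addrI/oppr_inj/mulIf; apply.
by rewrite invr_eq0.
Qed.

Lemma theta_surj (R : fieldType) (m : nat) (a : R) (c : nat -> R) :
  a != 0 ->
  exists2 x, x 0%N = a & forall j, (j < m)%N -> theta j.+1 x = c j.
Proof.
move=> a0; elim: m => [|m [x x0 xc]]; first by exists (fun=> a).
pose r := theta m.+1 x - x m.+1 / a.
pose y j := if j == m.+1 then (c m - r) * a else x j.
have eyx j : (j <= m)%N -> y j = x j by move=> le_jm; rewrite /y ltn_eqF.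
exists y; first by rewrite eyx.
move=> j; rewrite ltnS leq_eqVlt => /predU1P[->|lt_jm]; last first.
  rewrite -xc //; apply: eq_theta => k le_kj.
  by apply: eyx; apply: leq_trans le_kj lt_jm.
have /eqP := theta_triangular eyx; rewrite subr_eq (eyx 0%N) // x0 => /eqP ->.
by rewrite -/r /y eqxx mulfK // subrKC.
Qed.

(** * Rational points and Lang maps *)

Section LangMaps.

Variables (F : finFieldType) (K : fieldType) (f : {rmorphism F -> K}).

Local Notation q := #|F|.

Lemma rmorph_expf_card (a : F) : f a ^+ q = f a.
Proof. by rewrite -rmorphXn expf_card. Qed.

Lemma expf_card_rmorph (a : K) : a ^+ q = a -> exists b, a = f b.
Proof.
move=> ea; have : ('X^q - 'X).[a] == 0 by rewrite !hornerE ea subrr.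
have -> : 'X^q - 'X = map_poly f ('X^q - 'X).
  by rewrite rmorphB /= map_polyXn map_polyX.
rewrite finField_genPoly rmorph_prod horner_prod prodf_seq_eq0 => /hasP[b _].
by rewrite /= map_polyXsubC hornerXsubC subr_eq0 => /eqP; exists b.
Qed.

Lemma expf_card_rmorph_row (n : nat) (v : 'rV[K]_n) :
  map_mx (fun a => a ^+ q) v = v <-> exists w, v = map_mx f w.
Proof.
split=> [/rowP v_fixed|[w ->]]; last first.
  by apply/rowP => i; rewrite !mxE rmorph_expf_card.
have /choice[w vE] : forall i, exists b, v 0 i = f b.
  by move=> i; apply: expf_card_rmorph; have := v_fixed i; rewrite mxE.
by exists (\row_i w i); apply/rowP => i; rewrite !mxE.
Qed.

Lemma expf_cardD (a b : K) : (a + b) ^+ q = a ^+ q + b ^+ q.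
Proof.
have [p pr_p pF] := finPcharP F; apply: exprDn_pchar.
by rewrite (card_pprimeChar pF) pnatX pnatE // (rmorph_pchar f pF).
Qed.

(* The Lang maps x |-> x^-1 Frob(x) of the multiplicative and of the additive
   group. *)
Definition lang_mul (t : K) : K := t ^+ q.-1.
Definition lang_add (u : K) : K := u ^+ q - u.

Lemma finField_card_pred_gt0 : (0 < q.-1)%N.
Proof. by have := finNzRing_gt1 F; case: q => [|[]]. Qed.

Lemma lang_mul_eq0 (t : K) : (lang_mul t == 0) = (t == 0).
Proof. by rewrite expf_eq0 finField_card_pred_gt0. Qed.

Lemma expf_card_lang_mul (t : K) : t ^+ q = lang_mul t * t.
Proof. by rewrite -exprSr prednK // ltnW // finNzRing_gt1. Qed.

Lemma lang_mulM (s t : K) : lang_mul (s * t) = lang_mul s * lang_mul t.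
Proof. exact: exprMn. Qed.

Lemma lang_addD (u v : K) : lang_add (u + v) = lang_add u + lang_add v.
Proof. by rewrite /lang_add expf_cardD opprD addrACA. Qed.

Lemma lang_mul_kernel (t : K) :
  lang_mul t = 1 <-> exists2 a, a != 0 & t = f a.
Proof.
split=> [t1|[a a0 ->]].
  have [|a ta] := @expf_card_rmorph t.
    by rewrite expf_card_lang_mul t1 mul1r.
  by exists a; rewrite // -(fmorph_eq0 f) -ta -lang_mul_eq0 t1 oner_neq0.
have fa0 : f a != 0 by rewrite fmorph_eq0.
by apply: (mulIf fa0); rewrite -expf_card_lang_mul rmorph_expf_card mul1r.
Qed.

Lemma lang_add_kernel (u : K) : lang_add u = 0 <-> exists b, u = f b.
Proof.
split=> [/subr0_eq/expf_card_rmorph //|[b ->]].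
by rewrite /lang_add rmorph_expf_card subrr.
Qed.

Lemma lang_mul_fibre (t0 t : K) : t0 != 0 ->
  lang_mul t = lang_mul t0 <-> exists2 a, a != 0 & t = f a * t0.
Proof.
move=> t0_neq0; split=> [eq_lang|[a a0 ->]].
  have /lang_mul_kernel[a a0 ta] : lang_mul (t / t0) = 1.
    apply: (@mulIf _ (lang_mul t0)); first by rewrite lang_mul_eq0.
    by rewrite -lang_mulM divfK // mul1r.
  by exists a; rewrite // -ta divfK.
have fa1 : lang_mul (f a) = 1 by apply/lang_mul_kernel; exists a.
by rewrite lang_mulM fa1 mul1r.
Qed.

Lemma lang_add_fibre (u0 u : K) :
  lang_add u = lang_add u0 <-> exists b, u = u0 + f b.
Proof.
split=> [eq_lang|[b ->]].
  have /lang_add_kernel[b ub] : lang_add (u - u0) = 0.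
    by apply: (addIr (lang_add u0)); rewrite -lang_addD subrK add0r.
  by exists b; rewrite -ub subrKC.
have fb0 : lang_add (f b) = 0 by apply/lang_add_kernel; exists b.
by rewrite lang_addD fb0 addr0.
Qed.

Lemma lang_mul_row_fibre (n : nat) (t0 t : 'rV[K]_n) :
  (forall i, t0 0 i != 0) ->
  map_mx lang_mul t = map_mx lang_mul t0 <->
  exists2 a : 'rV[F]_n, (forall i, a 0 i != 0)
                      & t = \row_i (f (a 0 i) * t0 0 i).
Proof.
move=> t0_neq0; split=> [/rowP eq_lang|[a a0 ->]]; last first.
  by apply/rowP => i; rewrite !mxE; apply/lang_mul_fibre => //; exists (a 0 i).
have /choice[a aP] : forall i, exists a, a != 0 /\ t 0 i = f a * t0 0 i.
  move=> i; have /(lang_mul_fibre _ (t0_neq0 i))[a] :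
    lang_mul (t 0 i) = lang_mul (t0 0 i) by have := eq_lang i; rewrite !mxE.
  by exists a.
exists (\row_i a i) => [i|]; first by rewrite mxE; case: (aP i).
by apply/rowP => i; rewrite !mxE; case: (aP i).
Qed.

Lemma lang_add_row_fibre (n : nat) (u0 u : 'rV[K]_n) :
  map_mx lang_add u = map_mx lang_add u0 <->
  exists b : 'rV[F]_n, u = u0 + map_mx f b.
Proof.
split=> [/rowP eq_lang|[b ->]]; last first.
  by apply/rowP => i; rewrite !mxE; apply/lang_add_fibre; exists (b 0 i).
have /choice[b bP] : forall i, exists b, u 0 i = u0 0 i + f b.
  by move=> i; apply/lang_add_fibre; have := eq_lang i; rewrite !mxE.
by exists (\row_i b i); apply/rowP => i; rewrite !mxE.
Qed.

End LangMaps.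

Arguments lang_mul F {K} t.
Arguments lang_add F {K} u.

Lemma closed_field_expr_horner (K : closedFieldType) (n : nat) (p : {poly K}) :
  (0 < n)%N -> (size p <= n)%N -> exists x, x ^+ n = p.[x].
Proof.
move=> n_gt0 sz_p; have [x xn] := solve_monicpoly (fun i => p`_i) n_gt0.
by exists x; rewrite xn -horner_coef_wide.
Qed.

Lemma map_mx_surj (aT rT : Type) (g : aT -> rT) (m n : nat)
    (A : 'M[rT]_(m, n)) :
  (forall b, exists a, g a = b) -> exists B, map_mx g B = A.
Proof.
move=> /choice[g' g'K]; exists (map_mx g' A).
by apply/matrixP => i j; rewrite !mxE.
Qed.

Lemma lang_mul_surj (F : finFieldType) (K : closedFieldType) (c : K) :
  exists t, lang_mul F t = c.
Proof.
have [|t] := closed_field_expr_horner (finField_card_pred_gt0 F) (p := c%:P).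
  by rewrite (leq_trans (size_polyC_leq1 c)) ?finField_card_pred_gt0.
by rewrite hornerC; exists t.
Qed.

Lemma lang_add_surj (F : finFieldType) (K : closedFieldType) (c : K) :
  exists u, lang_add F u = c.
Proof.
have q_gt1 := finNzRing_gt1 F.
have [|u] := closed_field_expr_horner (ltnW q_gt1) (p := 'X + c%:P).
  by rewrite size_XaddC.
by rewrite !hornerE => uq; exists u; rewrite /lang_add uq addrC addKr.
Qed.

(** * The group H_Delta *)

Section BlockDiagonal.

Variables (F : finFieldType) (l : nat) (Delta : 'I_l -> nat).
Hypothesis Delta_gt0 : forall i, (0 < Delta i)%N.

Local Notation n := (\sum_i Delta i)%N.
Local Notation m := (\sum_i (Delta i).-1)%N.

Definition diag_toep (x : 'I_l -> nat -> F) : 'M[F]_n :=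
  \mxdiag_i toep (Delta i) (x i).

Lemma mxdiag_in_HDelta (A : forall i, 'M[F]_(Delta i)) :
  (\mxdiag_i A i \in HDelta F Delta) = [forall i, A i \in J F (Delta i)].
Proof.
apply/imsetP/forallP => [[B /setXnP BJ /eq_mxdiagP AB] i|AJ].
  by rewrite AB BJ.
exists [ffun i => A i] => /=; first by apply/setXnP => i; rewrite ffunE AJ.
by apply: eq_mxdiag => i; rewrite ffunE.
Qed.

Lemma diag_toep_in_HDelta (x : 'I_l -> nat -> F) :
  (diag_toep x \in HDelta F Delta) = [forall i, x i 0%N != 0].
Proof.
by rewrite mxdiag_in_HDelta; apply: eq_forallb => i; rewrite toep_in_J.
Qed.

Lemma HDelta_diag_toep (h : 'M[F]_n) :
  h \in HDelta F Delta -> exists x, h = diag_toep x.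
Proof.
case/imsetP => B /setXnP BJ ->.
have /choice[x Bx] : forall i, exists x, B i = toep (Delta i) x.
  by move=> i; apply: J_toep (BJ i).
by exists x; apply: eq_mxdiag.
Qed.

Lemma iotat_diag_toep (x : 'I_l -> nat -> F) :
  iotat (diag_toep x) =
  (\row_i x i 0%N, \mxrow_i \row_(j < (Delta i).-1) theta j.+1 (x i)).
Proof.
rewrite /iotat; congr (_, _).
  by apply/rowP => i; rewrite !mxE submxblock_diag entry_toep.
apply: eq_mxrow => i; apply/rowP => j; rewrite !mxE submxblock_diag.
apply: eq_theta => k le_kj; apply: entry_toep.
by rewrite (leq_ltn_trans le_kj) // -ltn_predRL.
Qed.

Lemma iotat_neq0 (h : 'M[F]_n) (i : 'I_l) :
  h \in HDelta F Delta -> (iotat h).1 0 i != 0.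
Proof.
move=> hH; have [x hx] := HDelta_diag_toep hH; move: hH.
by rewrite hx iotat_diag_toep diag_toep_in_HDelta mxE => /forallP.
Qed.

Lemma iotat_inj : {in HDelta F Delta &, injective (@iotat F l Delta)}.
Proof.
move=> g h gH hH; have [x gx] := HDelta_diag_toep gH.
have [y hy] := HDelta_diag_toep hH.
move: gH; rewrite {}gx {}hy diag_toep_in_HDelta !iotat_diag_toep => /forallP x0.
case=> /rowP exy0 /eq_mxrowP exy.
apply: eq_mxdiag => i; apply: eq_toep => j lt_j.
apply: (@theta_inj _ (Delta i).-1) => // [|k lt_k|].
- by have := exy0 i; rewrite !mxE.
- by have /rowP/(_ (Ordinal lt_k)) := exy i; rewrite !mxE.
- by rewrite -ltnS prednK.
Qed.

Lemma iotat_surj (g : GDeltaT F Delta) : (forall i, g.1 0 i != 0) ->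
  exists2 h, h \in HDelta F Delta & iotat h = g.
Proof.
case: g => a b /= a0.
have /choice[x xP] : forall i, exists x, x 0%N = a 0 i /\
    forall j, (j < (Delta i).-1)%N -> theta j.+1 x = entry (submxrow b i) 0 j.
  move=> i.
  have [x] := theta_surj (Delta i).-1 (entry (submxrow b i) 0) (a0 i).
  by exists x.
have x0 i : x i 0%N = a 0 i by case: (xP i).
exists (diag_toep x).
  by rewrite diag_toep_in_HDelta; apply/forallP => i; rewrite x0.
rewrite iotat_diag_toep; congr (_, _); first by apply/rowP => i; rewrite mxE.
apply/submxrowP => i; apply/rowP => j; rewrite mxrowK mxE.
by have [_ ->] := xP i; rewrite // (entry_ord _ ord0).
Qed.

Lemma char_mxdiag (chi : 'M[F]_n -> algC) (A : forall i, 'M[F]_(Delta i)) :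
  is_char_HDelta chi -> \mxdiag_i A i \in HDelta F Delta ->
  chi (\mxdiag_i A i) = \prod_i char_block chi (A i).
Proof.
move=> [chi1 chiM]; rewrite mxdiag_in_HDelta => /forallP AJ.
pose trunc (r : seq 'I_l) i := if i \in r then A i else 1%:M.
have truncH r : \mxdiag_i trunc r i \in HDelta F Delta.
  rewrite mxdiag_in_HDelta; apply/forallP => i; rewrite /trunc.
  by case: ifP => // _; apply: scalar1_in_J.
have single i : \mxdiag_k dfwith (fun k => 1%:M) (A i) k
    = \mxdiag_k trunc [:: i] k.
  apply: eq_mxdiag => k; rewrite /trunc inE; case: dfwithP => [|j neq_ij].
    by rewrite eqxx.
  by rewrite eq_sym (negbTE neq_ij).
suff chi_trunc r : uniq r ->
    chi (\mxdiag_i trunc r i) = \prod_(i <- r) char_block chi (A i).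
  rewrite -(chi_trunc _ (index_enum_uniq _)); congr chi.
  by apply: eq_mxdiag => i; rewrite /trunc mem_index_enum.
elim: r => [_|i r IHr /= /andP[i_notin uniq_r]].
  by rewrite big_nil -[RHS]chi1 -mxdiagZ.
rewrite big_cons -IHr // /char_block single -chiM //; congr chi.
rewrite mul_mxdiag; apply: eq_mxdiag => k; rewrite /trunc !inE.
have [->|_] := eqVneq k i; last by rewrite mul1mx.
by rewrite (negbTE i_notin) mulmx1.
Qed.

(** * The twisted points of X_(Delta, z) *)

Section TwistedPoints.

Variables (d : nat) (z : 'M[F]_(d, n)).

(* The matrix written sz in chi(sz). *)
Definition block_toep (s : 'rV[F]_d) : 'M[F]_n :=
  diag_toep (block_seq s z).

Lemma char_atE (chi : 'M[F]_n -> algC) (s : 'rV[F]_d) :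
  is_char_HDelta chi ->
  char_at chi s z =
  if block_toep s \in HDelta F Delta then chi (block_toep s) else 0.
Proof.
move=> chi_char; case: ifPn => [szH|].
  rewrite char_mxdiag //; apply: eq_bigr => i _ /=.
  by move: szH; rewrite diag_toep_in_HDelta => /forallP ->.
rewrite diag_toep_in_HDelta => /forallPn[i /negPn/eqP s0].
by rewrite /char_at (bigD1 i) //= s0 eqxx mul0r.
Qed.

Lemma map_block_seq (R : pzRingType) (f : {rmorphism F -> R}) (s : 'rV[F]_d)
    (i : 'I_l) :
  block_seq (map_mx f s) (map_mx f z) i = f \o block_seq s z i.
Proof.
by apply: funext => j; rewrite /block_seq map_submxrow -map_mxM map_entry.
Qed.

Definition XDelta_twisted (K : fieldType) (f : {rmorphism F -> K})
    (h : 'M[F]_n) : set (ptT Delta K d) :=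
  twisted_points (XDelta f z) (@FrobP F l Delta K d) (@actH F l Delta K f d) h.

Section Equations.

Variables (K : fieldType) (f : {rmorphism F -> K}).

Lemma XDelta_rationalP (t : 'rV[K]_l) (u : 'rV[K]_m) (s : 'rV[F]_d) :
  XDelta f z (t, u, map_mx f s) <->
  [/\ block_toep s \in HDelta F Delta,
      map_mx (lang_mul F) t = map_mx f (iotat (block_toep s)).1
    & map_mx (lang_add F) u = map_mx f (iotat (block_toep s)).2].
Proof.
rewrite /XDelta diag_toep_in_HDelta iotat_diag_toep /=; split.
  move=> XP; have tN i : t 0 i ^+ #|F|.-1 = f (block_seq s z i 0%N).
    by have [+ _ _] := XP i; rewrite map_block_seq.
  have sz0 i : f (block_seq s z i 0%N) != 0.
    by have [_ _] := XP i; rewrite -tN -[_ ^+ _]/(lang_mul F _) lang_mul_eq0.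
  split; first by apply/forallP => i; rewrite -(fmorph_eq0 f).
    by apply/rowP => i; rewrite !mxE -tN.
  apply/submxrowP => i; apply/rowP => j.
  rewrite !map_submxrow mxrowK !mxE /lang_add -map_theta.
  apply/theta_barP; first exact: sz0.
  have [_ + _] := XP i; rewrite map_block_seq => /(_ j).
  by rewrite exprM tN mxE.
case=> /forallP sz0 /rowP tN /submxrowP uN i.
have {}tN : t 0 i ^+ #|F|.-1 = f (block_seq s z i 0%N).
  by have := tN i; rewrite !mxE.
rewrite map_block_seq; split=> [//|j|]; last first.
  by rewrite -(lang_mul_eq0 F) /lang_mul tN fmorph_eq0.
rewrite exprM tN; apply/theta_barP; first by rewrite /= fmorph_eq0.
have /rowP/(_ j) := uN i; rewrite !map_submxrow mxrowK !mxE.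
by rewrite map_theta => <-.
Qed.

Lemma FrobP_actG (t : 'rV[K]_l) (u : 'rV[K]_m) (s : 'rV[K]_d)
    (g : GDeltaT F Delta) :
  (forall i, t 0 i != 0) ->
  @FrobP F l Delta K d (t, u, s) = actG f g (t, u, s) <->
  [/\ map_mx (lang_mul F) t = map_mx f g.1,
      map_mx (lang_add F) u = map_mx f g.2
    & exists s', s = map_mx f s'].
Proof.
move=> t_neq0; split=> [[/rowP tE /rowP uE sE]|].
  split; last exact/expf_card_rmorph_row; apply/rowP => i.
    by apply: (mulIf (t_neq0 i)); have := tE i; rewrite !mxE expf_card_lang_mul.
  by have := uE i; rewrite !mxE /lang_add => ->; rewrite addrAC subrr add0r.
case=> /rowP tE /rowP uE /expf_card_rmorph_row sE.
congr (_, _, _) => //; apply/rowP => i.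
  by have := tE i; rewrite !mxE expf_card_lang_mul => ->.
by have := uE i; rewrite !mxE => <-; rewrite subrKC.
Qed.

Lemma XDelta_twistedP (h : 'M[F]_n) (t : 'rV[K]_l) (u : 'rV[K]_m)
    (s : 'rV[K]_d) :
  h \in HDelta F Delta ->
  XDelta_twisted f h (t, u, s) <->
  [/\ map_mx (lang_mul F) t = map_mx f (iotat h).1,
      map_mx (lang_add F) u = map_mx f (iotat h).2
    & exists2 s', block_toep s' = h & s = map_mx f s'].
Proof.
move=> hH; split.
  case=> XP; have t_neq0 i : t 0 i != 0 by have [] := XP i.
  move=> /(FrobP_actG _ _ _ t_neq0)[tE uE [s' sE]]; split=> //; exists s' => //.
  move: XP; rewrite sE => /XDelta_rationalP[szH]; rewrite tE uE.
  move=> /map_mx_inj eq_t /map_mx_inj eq_u; apply: iotat_inj => //.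
  by rewrite [LHS]surjective_pairing -eq_t -eq_u -surjective_pairing.
case=> tE uE [s' sz_h ->].
have XP : XDelta f z (t, u, map_mx f s').
  by apply/XDelta_rationalP; rewrite sz_h.
split=> //; apply/FrobP_actG; first by move=> i; have [] := XP i.
by split=> //; exists s'.
Qed.

Lemma actH_free (t : 'rV[K]_l) (u : 'rV[K]_m) (s : 'rV[K]_d) :
  (forall i, t 0 i != 0) ->
  {in HDelta F Delta &, injective (fun g => actH f g (t, u, s))}.
Proof.
move=> t_neq0 g g' gH gH' [/rowP eq_t /addrI/map_mx_inj eq_u].
apply: iotat_inj => //; congr (_, _); last exact: eq_u.
apply/rowP => i; have := eq_t i.
by rewrite !mxE => /(mulIf (t_neq0 i))/fmorph_inj.
Qed.

Lemma XDelta_twisted_torsor (h : 'M[F]_n) (t0 : 'rV[K]_l) (u0 : 'rV[K]_m)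
    (P : ptT Delta K d) :
  h \in HDelta F Delta -> (forall i, t0 0 i != 0) ->
  map_mx (lang_mul F) t0 = map_mx f (iotat h).1 ->
  map_mx (lang_add F) u0 = map_mx f (iotat h).2 ->
  XDelta_twisted f h P <->
  exists g s, [/\ g \in HDelta F Delta, block_toep s = h
                & P = actH f g (t0, u0, map_mx f s)].
Proof.
move=> hH t0_neq0 t0E u0E; split=> [|[g [s [gH sz_h ->]]]].
  case: P => -[t u] s /XDelta_twistedP[] //; rewrite -t0E -u0E.
  move=> /(lang_mul_row_fibre f _ t0_neq0)[a a0 ->].
  move=> /(lang_add_row_fibre f)[b ->] [s' sz_h ->].
  have [g gH gE] := iotat_surj (g := (a, b)) a0.
  by exists g, s'; rewrite /actH gE.
apply/XDelta_twistedP => //; split; last by exists s.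
- rewrite -t0E; apply/(lang_mul_row_fibre f _ t0_neq0).
  by exists (iotat g).1 => // i; apply: iotat_neq0.
- by rewrite -u0E; apply/(lang_add_row_fibre f); exists (iotat g).2.
Qed.

End Equations.

Lemma card_XDelta_twisted (K : closedFieldType) (f : {rmorphism F -> K})
    (h : 'M[F]_n) :
  h \in HDelta F Delta ->
  #|` fset_set (XDelta_twisted f h)|
  = (#|HDelta F Delta| * #|[set s | block_toep s == h]|)%N.
Proof.
move=> hH.
have [t0 t0E] := map_mx_surj (map_mx f (iotat h).1) (@lang_mul_surj F K).
have [u0 u0E] := map_mx_surj (map_mx f (iotat h).2) (@lang_add_surj F K).
have t0_neq0 i : t0 0 i != 0.
  have /rowP/(_ i) := t0E; rewrite [LHS]mxE [RHS]mxE => t0i.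
  by rewrite -(lang_mul_eq0 F) t0i fmorph_eq0 iotat_neq0.
pose pt (gs : 'M[F]_n * 'rV[F]_d) : ptT Delta K d :=
  actH f gs.1 (t0, u0, map_mx f gs.2).
pose orbits := finset.setX (HDelta F Delta) [set s | block_toep s == h].
have pt_inj : {in orbits &, injective pt}.
  move=> [g s] [g' s']; rewrite !inE => /andP[/= gH _] /andP[/= gH' _] eq_pt.
  have /map_mx_inj eq_s : map_mx f s = map_mx f s' := congr1 snd eq_pt.
  by rewrite {}eq_s in eq_pt *; rewrite (actH_free t0_neq0 gH gH' eq_pt).
suff -> : XDelta_twisted f h = [set` [fset pt gs | gs in orbits]%fset]%classic.
  by rewrite set_fsetK card_in_imfset //= -cardE cardsX.
apply/seteqP; split=> P.
  case/(XDelta_twisted_torsor P hH t0_neq0 t0E u0E)=> g [s [gH sz_h ->]].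
  by apply/imfsetP; exists (g, s); rewrite // !inE /= gH sz_h eqxx.
case/imfsetP=> -[g s] /=; rewrite !inE => /andP[gH /eqP sz_h] ->.
by apply/(XDelta_twisted_torsor _ hH t0_neq0 t0E u0E); exists g, s.
Qed.

End TwistedPoints.
End BlockDiagonal.

Lemma twisted_count_fibres (T : choiceType) (gT S : finType) (X : set T)
    (Frob : T -> T) (G : {set gT}) (act : gT -> T -> T) (chi : gT -> algC)
    (v : S -> gT) :
  {in G, forall h, #|` fset_set (twisted_points X Frob act h)|
                   = (#|G| * #|[set s | v s == h]|)%N} ->
  twisted_count X Frob G act chi = \sum_(s | v s \in G) chi (v s).
Proof.
move=> card_fibre.
rewrite (partition_big v (mem G)) //= /twisted_count mulr_sumr.
apply: eq_bigr => h hG; rewrite card_fibre // natrM mulrCA mulKf; last first.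
  by rewrite Num.Theory.pnatr_eq0 -lt0n; apply/card_gt0P; exists h.
rewrite -sum1_card natr_sum mulr_sumr.
apply: eq_big => s; rewrite inE; last by move/eqP ->; rewrite mulr1.
by case: eqP => [->|]; rewrite ?hG ?andbF.
Qed.

Theorem theorem4p4 (F : finFieldType) (p : nat) (hp : p \in [pchar F])
  (* K, via f, is an algebraic closure of F *)
  (K : closedFieldType) (f : {rmorphism F -> K}) (hK : integralRange f)
  (l : nat) (Delta : 'I_l -> nat)
  (Delta_gt0 : forall i, (0 < Delta i)%N)
  (Delta_sorted : forall i j : 'I_l, (i <= j)%N -> (Delta i <= Delta j)%N)
  (Delta_le_p : forall i, (Delta i <= p)%N)
  (d : nat) (z : 'M[F]_(d, \sum_i Delta i))
  (chi : 'M[F]_(\sum_i Delta i) -> algC) (hchi : is_char_HDelta chi) :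
  NX f z chi = Phi chi z.
Proof.
rewrite /NX (twisted_count_fibres chi (v := block_toep z)) => [|h hH].
  rewrite big_mkcond; apply: eq_bigr => s _.
  by rewrite (char_atE Delta_gt0 z s hchi).
exact: card_XDelta_twisted.
Qed.
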